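(* Let $\beta\in(1,+\infty)$ be fixed, let $\{B_n\}_{n\in\mathbb{N}}$ be the $\beta$ matrix-sequence, and let $S^1=\{z\in\mathbb{C}:|z|=1\}$. Then $\{B_n\}_{n\in\mathbb{N}}$ is strongly clustered (in the eigenvalue sense) at $S^1$. In addition: (i) If $\beta\in[2,+\infty)$, then for every $\epsilon>0$ there is $N_\epsilon\in\mathbb{N}$ such that for all $n\ge N_\epsilon$ no eigenvalue of $B_n$ lies at distance greater than $\epsilon$ from $S^1$. (ii) If $\beta\in(1,2)$, then for all sufficiently large $n$ there are two eigenvalues $\lambda_n,\mu_n$ of $B_n$ (the outliers), both real and positive, with $\lambda_n\to(\beta-1)^{-1}$ and $\mu_n\to\beta-1$ as $n\to\infty$, such that for every $\epsilon>0$ and all sufficiently large $n$ (depending on $\epsilon$), every eigenvalue of $B_n$ other than these two lies at distance at most $\epsilon$ from $S^1$ (eigenvalues being counted with algebraic multiplicity).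
   Context: For $n\ge 1$ and $\beta>1$, let $e_1,\dots,e_n$ be the canonical basis of $\mathbb{C}^n$ (column vectors), $e=\sum_{j=1}^n e_j$ the all-ones vector, and $v\in\mathbb{C}^n$ the vector with entries $v_j=\beta^{-j}$, $j=1,\dots,n$. Let $T_n(e^{\mathbf{i}\theta})$ be the $n\times n$ matrix with $(s,t)$ entry equal to $1$ if $s-t=1$ and $0$ otherwise (ones on the first subdiagonal, zeros elsewhere). The $\beta$ matrix of order $n$ is $$B_n=T_n(e^{\mathbf{i}\theta})+(v-e_1)e^{T},$$ i.e. the $(s,t)$ entry of $B_n$ is $\beta^{-s}-\delta_{s,1}+\delta_{s,t+1}$, where $\delta$ is the Kronecker delta. A matrix-sequence $\{X_n\}_{n\in\mathbb{N}}$, with $X_n$ an $n\times n$ complex matrix, is strongly clustered (in the eigenvalue sense) at a closed set $S\subset\mathbb{C}$ if for every $\epsilon>0$ the number of eigenvalues of $X_n$ (counted with algebraic multiplicity) whose distance from $S$ is larger than $\epsilon$ is $O(1)$ as $n\to\infty$. *)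

(* Defs.v *)
From HB Require Import structures.
From mathcomp Require Import all_boot all_order all_algebra.
From mathcomp Require Import all_classical all_reals all_analysis.
From mathcomp Require Import complex.
Set Implicit Arguments.
Unset Strict Implicit.
Unset Printing Implicit Defensive.
Import Order.TTheory GRing.Theory Num.Theory.
Import numFieldNormedType.Exports.
Import ComplexField.
Local Open Scope classical_set_scope.
Local Open Scope complex_scope.
Local Open Scope ring_scope.

Section Defs.
Variable R : realType.

Definition unit_circle : set R[i] := [set z | `|z| = 1].

(* Extended-real valued so that the distance to the empty set is +oo. *)
Definition cdist (z : R[i]) (S : set R[i]) : \bar R :=
  ereal_inf [set (Normc.normc (z - w))%:E | w in S].

Definition cclosed (S : set R[i]) : Prop :=
  closed (S : set (R[i] : numFieldType)).

(* The eigenvalues of A, repeated according to algebraic multiplicity, in an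
   unspecified order. *)
Definition eigenvalues n (A : 'M[R[i]]_n) : seq R[i] :=
  sval (closed_field_poly_normal (char_poly A)).

Lemma char_poly_eigenvalues n (A : 'M[R[i]]_n) :
  char_poly A = \prod_(z <- eigenvalues A) ('X - z%:P).
Proof.
rewrite /eigenvalues; case: closed_field_poly_normal => r /= {1}->.
by rewrite (monicP (char_poly_monic A)) scale1r.
Qed.

Lemma mem_eigenvalues n (A : 'M[R[i]]_n) z :
  (z \in eigenvalues A) = eigenvalue A z.
Proof.
by rewrite eigenvalue_root_char char_poly_eigenvalues root_prod_XsubC.
Qed.

Definition strongly_clustered (X : forall n, 'M[R[i]]_n) (S : set R[i]) : Prop :=
  cclosed S /\
  forall eps : R, 0 < eps ->
    exists C : nat, \forall n \near \oo,
      (count (fun z => (eps%:E < cdist z S)%E) (eigenvalues (X n)) <= C)%N.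

(* In the three definitions below the 0-based ordinal s stands for the 1-based
   index s + 1. *)
Definition shift_mx n : 'M[R[i]]_n :=
  \matrix_(s, t) ((s : nat) == t.+1)%:R.

Definition first_vec n : 'cV[R[i]]_n := \col_s ((s : nat) == 0%N)%:R.

Definition geom_vec (beta : R) n : 'cV[R[i]]_n := \col_s (beta ^- s.+1)%:C.

Definition beta_mx (beta : R) n : 'M[R[i]]_n :=
  shift_mx n + (geom_vec beta n - first_vec n) *m (const_mx 1 : 'cV[R[i]]_n)^T.

Lemma beta_mxE (beta : R) n (s t : 'I_n) :
  beta_mx beta n s t =
    (beta ^- s.+1)%:C - (s == 0 :> nat)%:R + (s == t.+1 :> nat)%:R.
Proof. by rewrite !mxE big_ord1 !mxE mulr1 addrC. Qed.

End Defs.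

Arguments unit_circle {R}.

(* Main.v *)
Require Import Defs.
From mathcomp Require Import all_boot all_order all_algebra.
From mathcomp Require Import all_classical all_reals all_analysis.
From mathcomp Require Import complex zify ring lra.

(** Put alpha = beta - 1 and let p_n be the characteristic polynomial of B_n.
    In the basis e_1 - e_2, ..., e_(n-1) - e_n, e_n the matrix B_n becomes the
    transpose of a companion matrix, so the coefficients of p_n are read off:
    p_n = X^n + sum_(m < n) a_m X^m with alpha a_m = alpha - 1 + beta^-(m+1).
    Summing the two geometric progressions hidden in these coefficients gives

      (X - 1) (X - beta) p_n        = (alpha - X) + I_n,
      alpha (1 - X) p_n^*           = (alpha - X) + O_n,

    where p_n^* = prod (1 - z X), over the eigenvalues z, is the reversed
    polynomial, whose roots are the inverses of the nonzero eigenvalues. The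
    coefficient of X^k in either error term is O(beta^(k - n)), so that both
    errors tend to 0 uniformly on every disc of radius r < 1, together with
    their divided differences ([geometric_vanishing]).

    Thus the eigenvalues inside the unit circle and the inverses of those
    outside are governed by one and the same situation: the zeros, in a disc of
    radius r < 1, of a small perturbation of alpha - X.
    - Such a zero is close to alpha. If alpha >= 1, there is none for large n
      ([no_zeros_in_disc]).
    - If alpha < 1, the intermediate value theorem gives a real zero near alpha.
      It is the only one, counted with multiplicity: dividing by (X - z) (X - w)
      makes the divided difference at z, w vanish, while that of alpha - X is
      -1 and that of the error is small ([one_zero_in_disc]).
    This elementary substitute for Rouche's theorem yields the outlier
    mu_n -> alpha from the first identity and lambda_n = 1 / nu_n -> 1 / alpha
    from the second, where nu_n -> alpha is the zero of p_n^*. All other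
    eigenvalues satisfy r < |z| < 1/r, for any fixed r < 1 and n large. *)

Import Order.TTheory GRing.Theory Num.Theory.
Import numFieldNormedType.Exports.
Local Open Scope classical_set_scope.
Local Open Scope complex_scope.
Local Open Scope ring_scope.
Set Implicit Arguments.
Unset Strict Implicit.

(** * The characteristic polynomial *)

Lemma det_lower_unitriangular (C : comNzRingType) n (A : 'M[C]_n) :
  is_trig_mx A -> (forall i, A i i = 1) -> \det A = 1.
Proof.
by move=> trigA diagA; rewrite det_trig // big1 // => i _; rewrite diagA.
Qed.

Lemma char_poly_tr (C : comNzRingType) n (A : 'M[C]_n) :
  char_poly A^T = char_poly A.
Proof.
rewrite /char_poly -[RHS]det_tr; congr (\det _).
by apply/matrixP => i j; rewrite !mxE eq_sym.
Qed.

(** A change of basis of determinant 1 needs no inverse, so this holds over any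
    commutative ring. *)
Lemma char_poly_similar (C : comNzRingType) n (A B G : 'M[C]_n) :
  \det G = 1 -> A *m G = G *m B -> char_poly A = char_poly B.
Proof.
move=> detG AG; have detGX : \det (map_mx polyC G) = 1.
  by rewrite det_map_mx detG rmorph1.
rewrite /char_poly -[LHS]mulr1 -[RHS]mul1r -detGX -!det_mulmx.
congr (\det _); rewrite /char_poly_mx mulmxBl mulmxBr.
by rewrite -!map_mxM AG mul_scalar_mx mul_mx_scalar.
Qed.

(** The dimension of [companionmx p] is [(size p).-1]; here it is a variable, so
    that the matrix can be compared with matrices of a given size. *)
Lemma char_poly_companion (C : comNzRingType) n (a : nat -> C) :
  char_poly (\matrix_(i < n, j < n)
    if i == n.-1 :> nat then - a j else (i.+1 == j :> nat)%:R)
  = 'X^n + \poly_(i < n) a i.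
Proof.
set p := 'X^n + _.
have size_p : size p = n.+1.
  by rewrite size_polyDl size_polyXn // ltnS size_poly.
have p_monic : p \is monic.
  rewrite monicE lead_coefE size_p /= coefD coefXn eqxx coef_poly ltnn.
  by rewrite addr0.
have p_coef (i : nat) : (i < n)%N -> p`_i = a i.
  by move=> lt_in; rewrite coefD coefXn coef_poly lt_in ltn_eqF // add0r.
have {}size_p : (size p).-1 = n by rewrite size_p.
move: p size_p p_monic p_coef => p; case: _ / => p_monic p_coef.
rewrite -[RHS]companionmxK // /char_poly; congr (\det (char_poly_mx _)).
by apply/matrixP => i j; rewrite !mxE p_coef.
Qed.

(** Let B be the shift plus u e^T, and g_s = e_s - e_(s+1) for s < n - 1 and
    g_(n-1) = e_(n-1). Then B g_s = g_(s+1), because e^T g_s = 0, and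
    B g_(n-1) = u = sum_t (u_0 + ... + u_t) g_t. In this basis B is therefore the
    transpose of a companion matrix. *)
Lemma char_poly_shift_rank1 (C : comNzRingType) n (u : nat -> C) :
  char_poly (\matrix_(s < n, t < n) (u s + (s == t.+1 :> nat)%:R))
  = 'X^n + \poly_(i < n) - \sum_(k < i.+1) u k.
Proof.
rewrite -char_poly_companion -[RHS]char_poly_tr; case: n => [|n].
  by congr (char_poly _); apply/matrixP => -[].
(* The columns of G are the vectors g_s. *)
pose G : 'M[C]_n.+1 :=
  \matrix_(i, j) ((i == j :> nat)%:R - (i == j.+1 :> nat)%:R).
apply: (@char_poly_similar _ _ _ _ G).
  apply: det_lower_unitriangular => [|i].
    apply/is_trig_mxP => i j lt_ij; rewrite mxE !ltn_eqF ?subrr //.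
    exact: ltnW.
  by rewrite mxE eqxx ltn_eqF ?subr0.
have sumr (F : 'I_n.+1 -> C) (t : 'I_n.+1) :
    \sum_(k < n.+1) F k * (k == t :> nat)%:R = F t.
  rewrite (bigD1 t) //= eqxx mulr1 big1 ?addr0 // => k /negPf kt.
  by rewrite (_ : _ == _ = false) ?mulr0.
have suml (F : 'I_n.+1 -> C) (t : 'I_n.+1) :
    \sum_(k < n.+1) (t == k :> nat)%:R * F k = F t.
  by under eq_bigr do rewrite mulrC eq_sym; rewrite sumr.
set K := (K in _ = _ *m K).
have KE (s t : 'I_n.+1) : K s t =
    if t == n :> nat then \sum_(k < s.+1) u k else (t.+1 == s :> nat)%:R.
  by rewrite !mxE opprK.
(* Multiplying K by the shift on the left moves its rows down by one. *)
have KE_pred (s t : 'I_n.+1) : \sum_(k < n.+1) (s == k.+1 :> nat)%:R * K k t =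
    if s == 0%N :> nat then 0 else
    if t == n :> nat then \sum_(k < s) u k else (t.+2 == s :> nat)%:R.
  case: s => -[|s] lt_s /=; first by rewrite big1 // => k _; rewrite mul0r.
  have:= suml (K^~ t) (Ordinal (ltnW lt_s)).
  by under eq_bigr do rewrite /= -eqSS; rewrite KE eqSS.
apply/matrixP => s t; rewrite !mxE.
under eq_bigr => k _ do rewrite [G _ _]mxE mulrBr.
under [RHS]eq_bigr => k _ do rewrite [G _ _]mxE mulrBl.
rewrite !sumrB sumr suml KE_pred KE !mxE.
case: (eqVneq (t : nat) n) => [tn|tn].
  rewrite big1 => [|k _]; last first.
    by rewrite tn (ltn_eqF (ltn_ord k)) mulr0.
  rewrite tn (ltn_eqF (ltn_ord s)) addr0 subr0.
  case: s => -[|s] lt_s /=; first by rewrite big_ord1 subr0.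
  by rewrite big_ord_recr /= [_ + u _]addrC addrK.
have lt_t : (t.+1 < n.+1)%N by rewrite ltnS ltn_neqAle tn -ltnS ltn_ord.
rewrite (sumr _ (Ordinal lt_t)) mxE /= [_ == t.+2]eq_sym [_ == t.+1]eq_sym.
rewrite opprD addrACA subrr add0r; congr (_ - _).
by case: s => -[].
Qed.

(** * Reversed polynomials *)

(** The reversal X^n p(1/X), with n an upper bound on the degree of p rather than
    its degree: this makes it commute with ring morphisms. *)
Definition revp (C : nzRingType) n (p : {poly C}) : {poly C} :=
  \poly_(i < n.+1) p`_(n - i).

Lemma revpMXsubC (C : comNzRingType) n (p : {poly C}) (z : C) :
  (size p <= n.+1)%N ->
  revp n.+1 (('X - z%:P) * p) = (1 - z *: 'X) * revp n p.
Proof.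
move=> size_p; apply/polyP => i.
rewrite [(1 - _) * _]mulrBl mul1r coefB -scalerAl coefZ coefXM !coef_poly.
rewrite mulrBl coefB coefXM coefCM.
case: i => [|i] /=; first by rewrite mulr0 !subn0 (nth_default _ size_p) mulr0.
rewrite subSS subn_eq0 ltnS.
have [lt_in|lt_ni|->] := ltngtP i n.
- by rewrite !ltnS ltnW // lt_in subnS.
- by rewrite !ltnS leqNgt lt_ni mulr0 subr0 ltnNge (ltnW lt_ni).
- by rewrite !ltnS leqnn ltnn.
Qed.

Lemma revp_prod_XsubC (C : comNzRingType) (zs : seq C) :
  revp (size zs) (\prod_(z <- zs) ('X - z%:P)) = \prod_(z <- zs) (1 - z *: 'X).
Proof.
elim: zs => [|z zs IHzs] /=.
  rewrite !big_nil; apply/polyP => i; rewrite coef_poly.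
  by rewrite !coef1; case: i.
by rewrite !big_cons revpMXsubC ?IHzs // size_prod_XsubC.
Qed.

(** * A norm controlling values and divided differences on a disc *)

(** The weight (k + 1) r^(k-1) is at least r^k, the bound for X^k on the disc of
    radius r <= 1, and k r^(k-1), the bound for its divided differences. *)
Definition disc_norm (F : numDomainType) (r : F) (p : {poly F}) : F :=
  \sum_(k < size p) `|p`_k| * (k.+1%:R * r ^+ k.-1).

Section DiscNorm.
Variables (F : numFieldType) (r : F).
Hypotheses (r_ge0 : 0 <= r) (r_le1 : r <= 1).
Implicit Types (p : {poly F}) (z w : F).

Lemma horner_le_disc_norm p z : `|z| <= r -> `|p.[z]| <= disc_norm r p.
Proof.
move=> zr; rewrite horner_coef (le_trans (ler_norm_sum _ _ _)) //.
apply: ler_sum => k _; rewrite normrM normrX ler_wpM2l //.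
apply: (@le_trans _ _ (r ^+ k.-1)).
  apply: (le_trans (lerXn2r k _ _ zr)); rewrite ?nnegrE //.
  by rewrite ler_wiXn2l // leq_pred.
by rewrite ler_peMl ?exprn_ge0 // ler1n.
Qed.

(** The quotient is sum_k p_k (z^(k-1) + z^(k-2) X + ... + X^(k-1)); working with
    it instead of the derivative treats double roots and pairs of distinct roots
    alike. *)
Lemma divided_difference p z : `|z| <= r ->
  exists2 q : {poly F}, p = p.[z]%:P + ('X - z%:P) * q
    & forall w, `|w| <= r -> `|q.[w]| <= disc_norm r p.
Proof.
move=> zr.
exists (\sum_(k < size p) p`_k *: \sum_(i < k) 'X ^+ (k.-1 - i) * z%:P ^+ i).
  rewrite mulr_sumr -{1}[p]coefK poly_def horner_coef rmorph_sum -big_split /=.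
  apply: eq_bigr => k _; rewrite -scalerAr -subrXX scalerBr rmorphM rmorphXn /=.
  by rewrite mul_polyC addrC subrK.
move=> w wr; rewrite horner_sum (le_trans (ler_norm_sum _ _ _)) //.
apply: ler_sum => k _; rewrite hornerZ normrM ler_wpM2l //.
rewrite horner_sum (le_trans (ler_norm_sum _ _ _)) //.
apply: (@le_trans _ _ (\sum_(i < k) r ^+ k.-1)).
  apply: ler_sum => i _; rewrite -rmorphXn /= hornerM hornerXn hornerC normrM !normrX.
  have -> : k.-1 = (k.-1 - i + i)%N by rewrite subnK // -ltnS prednK ?(leq_trans _ (ltn_ord i)).
  rewrite addnK exprD ler_pM ?exprn_ge0 // lerXn2r ?nnegrE //.
by rewrite sumr_const card_ord -[_ *+ k]mulr_natl ler_wpM2r ?exprn_ge0 // ler_nat.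
Qed.

(** As b and r are at most q, each term b^(N-k) r^(k-1) is at most q^(N-1);
    there are N + 1 of them, with factors at most N + 1. *)
Lemma disc_norm_le_geometric p N (M b q : F) : (size p <= N.+1)%N ->
  (forall k, (k <= N)%N -> `|p`_k| <= M * b ^+ (N - k)) ->
  0 <= b <= q -> r <= q <= 1 ->
  disc_norm r p <= M * (N.+1%:R ^+ 2 * q ^+ N.-1).
Proof.
move=> size_p p_le /andP[b_ge0 bq] /andP[rq q_le1].
have q_ge0 : 0 <= q by apply: le_trans bq.
have M_ge0 : 0 <= M by have:= p_le N (leqnn N); rewrite subnn mulr1; apply: le_trans.
apply: (@le_trans _ _ (\sum_(k < size p) M * (N.+1%:R * q ^+ N.-1))).
  apply: ler_sum => -[k lt_k] _ /=.
  have le_kN : (k <= N)%N by rewrite -ltnS (leq_trans lt_k).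
  apply: (le_trans (ler_wpM2r _ (p_le k le_kN))).
    by rewrite mulr_ge0 ?exprn_ge0.
  rewrite -mulrA ler_wpM2l // mulrCA ler_pM ?mulr_ge0 ?exprn_ge0 ?ler_nat //.
  apply: (@le_trans _ _ (q ^+ (N - k) * q ^+ k.-1)).
    by rewrite ler_pM ?exprn_ge0 // lerXn2r ?nnegrE.
  by rewrite -exprD ler_wiXn2l //; case: k lt_k le_kN => [|k] ? ? /=; lia.
rewrite sumr_const card_ord -[_ *+ size p]mulr_natl mulrCA ler_wpM2l // expr2 -mulrA.
by rewrite ler_wpM2r ?mulr_ge0 ?exprn_ge0 // ler_nat.
Qed.

End DiscNorm.

(** * Zeros of a linear polynomial under a small perturbation *)

Lemma perturbed_root_dist (F : numFieldType) (r alpha z : F) (S : {poly F}) :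
  0 <= r -> r <= 1 -> `|z| <= r -> root (alpha%:P - 'X + S) z ->
  `|z - alpha| <= disc_norm r S.
Proof.
move=> r_ge0 r_le1 zr; rewrite rootE !hornerE => /eqP Pz.
have -> : z - alpha = S.[z] by apply/eqP; rewrite -subr_eq0 -oppr_eq0 -Pz; apply/eqP; ring.
exact: horner_le_disc_norm.
Qed.

(** Two zeros z, w (possibly z = w) in the disc force the divided difference of S
    at z, w to cancel that of alpha - X, which is -1. *)
Lemma perturbed_root_simple (F : numFieldType) (r alpha z w : F)
    (S G : {poly F}) :
  0 <= r -> r <= 1 -> `|z| <= r -> `|w| <= r ->
  alpha%:P - 'X + S = ('X - z%:P) * (('X - w%:P) * G) ->
  1 <= disc_norm r S.
Proof.
move=> r_ge0 r_le1 zr wr PE.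
have [q SE q_le] := divided_difference r_ge0 S zr.
have Sz : S.[z] = z - alpha.
  have := congr1 (horner^~ z) PE; rewrite hornerM hornerXsubC subrr mul0r !hornerE => Pz.
  by apply/eqP; rewrite -subr_eq0 -Pz; apply/eqP; ring.
have qE : q = ('X - w%:P) * G + 1.
  apply: (mulfI (negbT (polyXsubC_eq0 z))).
  rewrite mulrDr -PE {1}SE Sz polyCB; ring.
have := q_le w wr.
by rewrite qE !hornerE subrr mul0r add0r normr1.
Qed.

Lemma perturbed_root_exists (R : rcfType) (r alpha delta : R) (S : {poly R}) :
  0 <= delta <= alpha -> alpha + delta <= r -> r <= 1 -> disc_norm r S <= delta ->
  exists2 x, alpha - delta <= x <= alpha + delta & root (alpha%:P - 'X + S) x.
Proof.
move=> /andP[d_ge0 da] adr r_le1 Sd.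
have S_le x : 0 <= x <= alpha + delta -> `|S.[x]| <= delta.
  move=> /andP[x_ge0 x_le]; apply: le_trans Sd.
  by apply: horner_le_disc_norm; rewrite ?ger0_norm //; lra.
have le_ab : alpha - delta <= alpha + delta by lra.
have [|x x_in] := @poly_ivt _ (- (alpha%:P - 'X + S)) _ _ le_ab.
  have := S_le (alpha - delta); have := S_le (alpha + delta).
  rewrite !hornerE !ler_norml => Sb Sa.
  have {}/andP[? ?] := Sa ltac:(lra); have {}/andP[? ?] := Sb ltac:(lra).
  lra.
by rewrite rootN; exists x.
Qed.
(** With q = exp(-c), the cubic term of the exponential series of c (n + 1) gives
    (n + 1)^3 q^(n+1) <= 6 / c^3. *)
Lemma geometric_sqr_cvg0 (R : realType) (q : R) : 0 < q < 1 ->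
  n.+1%:R ^+ 2 * q ^+ n @[n --> \oo] --> (0 : R).
Proof.
move=> /andP[q_gt0 q_lt1].
have [c c_gt0 qE] : exists2 c, 0 < c & q = expR (- c).
  by exists (- ln q); rewrite ?oppr_gt0 ?ln_lt0 ?q_gt0 // opprK lnK.
have bound_cvg : (6 / (c ^+ 3 * q)) * (n.+1%:R)^-1 @[n --> \oo] --> (0 : R).
  rewrite -[X in _ --> X](mulr0 (6 / (c ^+ 3 * q))).
  by apply: cvgMr; exact: cvg_harmonic.
apply: (squeeze_cvgr _ (cvg_cst 0) bound_cvg).
near=> n; apply/andP; split.
  by rewrite mulr_ge0 ?exprn_ge0 // ltW.
have n_gt0 : 0 < n.+1%:R :> R by rewrite ltr0n.
have x_gt0 : 0 < c * n.+1%:R by rewrite mulr_gt0.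
have := expR_ge1Dxn 2 (ltW x_gt0).
have -> : expR (c * n.+1%:R) = (q ^+ n.+1)^-1.
  by rewrite qE -expRM_natr mulNr expRN invrK.
set Q := q ^+ n.+1 => le_Q.
have Q_gt0 : 0 < Q by rewrite exprn_gt0.
have {}le_Q : (c * n.+1%:R) ^+ 3 * Q <= 6.
  have : (c * n.+1%:R) ^+ 3 / 6 <= Q^-1 by apply: le_trans le_Q; rewrite lerDr.
  by rewrite ler_pdivrMr // ler_pdivlMl // mulrC.
have -> : q ^+ n = Q / q by rewrite /Q exprSr mulfK // gt_eqF.
rewrite ler_pdivlMr // mulrA ler_pdivlMr ?mulr_gt0 ?exprn_gt0 //.
apply: le_trans le_Q; rewrite le_eqVlt; apply/orP; left; apply/eqP.
by field; rewrite gt_eqF.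
Unshelve. all: by end_near. Qed.

(** Coefficientwise control, uniform in the degree, which yields locally uniform
    convergence to 0 on the open unit disc of both the values and the divided
    differences. *)
Definition vanishing (R : realType) (S : nat -> {poly R}) : Prop :=
  forall r : R, 0 <= r < 1 -> disc_norm r (S n) @[n --> \oo] --> (0 : R).

Lemma geometric_vanishing (R : realType) (S : nat -> {poly R}) (M b : R) :
  0 < b < 1 -> (forall n, size (S n) <= n.+3)%N ->
  (forall n k, (k <= n.+2)%N -> `|(S n)`_k| <= M * b ^+ (n.+2 - k)) ->
  vanishing S.
Proof.
move=> /andP[b_gt0 b_lt1] size_S S_le r /andP[r_ge0 r_lt1].
pose q := Num.max b r.
have q_gt0 : 0 < q by rewrite lt_max b_gt0.
have q_lt1 : q < 1 by rewrite gt_max b_lt1.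
have bound_cvg : (M / q) * (n.+3%:R ^+ 2 * q ^+ n.+2) @[n --> \oo] --> (0 : R).
  rewrite -[X in _ --> X](mulr0 (M / q)); apply: cvgMr.
  have := @geometric_sqr_cvg0 R q; rewrite q_gt0 => /(_ q_lt1).
  by rewrite -(cvg_shiftn 2); under eq_fun do rewrite addn2.
apply: (squeeze_cvgr _ (cvg_cst 0) bound_cvg).
near=> n; apply/andP; split.
  by apply: sumr_ge0 => k _; rewrite !mulr_ge0 // exprn_ge0.
have -> : M / q * (n.+3%:R ^+ 2 * q ^+ n.+2) = M * (n.+3%:R ^+ 2 * q ^+ n.+1).
  by rewrite [q ^+ n.+2]exprS; field; rewrite gt_eqF.
apply: (disc_norm_le_geometric r_ge0 (ltW r_lt1) (size_S n) (S_le n)).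
  by rewrite ltW //= le_max lexx.
by rewrite le_max lexx orbT ltW.
Unshelve. all: by end_near. Qed.

(** * Zeros of a sequence converging to a linear polynomial in the disc *)

Lemma normr_real_complex (R : rcfType) (x : R) : `|x%:C| = `|x|%:C.
Proof. by rewrite normc_def /= expr0n addr0 sqrtr_sqr. Qed.

Lemma normr_normc (R : rcfType) (z : R[i]) : `|z| = (Normc.normc z)%:C.
Proof. by case: z. Qed.

Lemma disc_norm_complex (R : rcfType) (r : R) (p : {poly R}) :
  disc_norm r%:C (map_poly (real_complex R) p) = (disc_norm r p)%:C.
Proof.
rewrite /disc_norm size_map_poly rmorph_sum; apply: eq_bigr => k _ /=.
by rewrite coef_map /= normr_real_complex !rmorphM rmorphXn rmorph_nat.
Qed.

Lemma map_perturbed_linear (R : rcfType) (alpha : R) (S : {poly R}) :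
  map_poly (real_complex R) (alpha%:P - 'X + S) =
  (alpha%:C)%:P - 'X + map_poly (real_complex R) S.
Proof. by rewrite rmorphD rmorphB /= map_polyC map_polyX. Qed.

(** The list [ws n] holds the zeros of alpha - X + S_n other than those of a
    factor A_n without zeros in the open unit disc. *)
Section ZerosInDisc.
Variables (R : realType) (alpha : R) (S : nat -> {poly R}).
Variables (A : nat -> {poly R[i]}) (ws : nat -> seq R[i]).
Hypothesis S_vanishing : vanishing S.
Hypothesis A_root : forall n z, `|z| < 1 -> ~~ root (A n) z.
Hypothesis PE : forall n, map_poly (real_complex R) (alpha%:P - 'X + S n) =
  A n * \prod_(w <- ws n) ('X - w%:P).

Lemma zero_dist n (r : R) (w : R[i]) : 0 <= r <= 1 -> w \in ws n ->
  Normc.normc w <= r -> `|w - alpha%:C| <= (disc_norm r (S n))%:C.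
Proof.
move=> /andP[r_ge0 r_le1] w_in wr; rewrite -disc_norm_complex.
apply: perturbed_root_dist; rewrite ?lecR ?ler0c ?normr_normc ?lecR //.
by rewrite -map_perturbed_linear PE rootM root_prod_XsubC w_in orbT.
Qed.

Lemma no_zeros_in_disc (r : R) : 1 <= alpha -> 0 <= r < 1 ->
  \forall n \near \oo, forall w, w \in ws n -> r < Normc.normc w.
Proof.
move=> alpha_ge1 /andP[r_ge0 r_lt1].
have r_in : 0 <= r < 1 by rewrite r_ge0.
have d_gt0 : 0 < 1 - r by rewrite subr_gt0.
have small : \forall n \near \oo, disc_norm r (S n) < 1 - r.
  exact: cvgr_lt _ (S_vanishing r_in) _ d_gt0.
near=> n => w w_in; rewrite ltNge; apply/negP => wr.
have r_le1 : 0 <= r <= 1 by rewrite r_ge0 ltW.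
have := zero_dist r_le1 w_in wr.
have := ler_normB w (w - alpha%:C).
rewrite subKr normr_real_complex (normr_normc w) (normr_normc (w - _)).
rewrite -rmorphD /= !lecR.
have small_n : disc_norm r (S n) < 1 - r by near: n.
move=> alpha_le dist_le.
by have := ler_norm alpha; lra.
Unshelve. all: by end_near. Qed.

(** Existence comes from the intermediate value theorem on an interval around
    alpha inside ]0, 1[. The last clause is uniqueness with multiplicity: once
    x_n is taken out of the list, any remaining zero w has modulus above r. *)
Lemma one_zero_in_disc : 0 < alpha < 1 ->
  exists x : nat -> R,
  [/\ x @ \oo --> alpha,
      \forall n \near \oo, 0 < x n < 1 /\ (x n)%:C \in ws n
    & forall r : R, 0 <= r < 1 -> \forall n \near \oo, forall w rest,
        perm_eq (ws n) [:: (x n)%:C, w & rest] -> r < Normc.normc w].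
Proof.
move=> /andP[alpha_gt0 alpha_lt1].
have [delta [d_gt0 d1 d2]] :
    exists d, [/\ 0 < d, d < alpha & alpha + d < 1].
  have [m [m_gt0 m1 m2]] : exists m, [/\ 0 < m, m <= alpha & m <= 1 - alpha].
    exists (Num.min alpha (1 - alpha)).
    by rewrite lt_min !ge_min !lexx orbT alpha_gt0 subr_gt0.
  by exists (m / 2); split; lra.
pose r0 := alpha + delta.
have r0_in : 0 <= r0 < 1 by rewrite /r0; lra.
have r0_le1 : r0 <= 1 by rewrite /r0; lra.
(* The zero is chosen in one fixed interval around alpha; its convergence to
   alpha then follows from the smallness of S_n at this zero. *)
have [x xP] : {x : nat -> R & forall n, disc_norm r0 (S n) <= delta ->
    alpha - delta <= x n <= r0 /\ root (alpha%:P - 'X + S n) (x n)}.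
  apply: (@choice _ _ (fun n x => disc_norm r0 (S n) <= delta ->
    alpha - delta <= x <= r0 /\ root (alpha%:P - 'X + S n) x)) => n.
  have [le_d|] := leP (disc_norm r0 (S n)) delta; last by exists 0.
  have d_in : 0 <= delta <= alpha by lra.
  have [x ? ?] := perturbed_root_exists d_in (lexx r0) r0_le1 le_d.
  by exists x.
have small : \forall n \near \oo, disc_norm r0 (S n) <= delta.
  exact: cvgr_le _ (S_vanishing r0_in) _ d_gt0.
exists x; split.
- apply/cvgrPdist_le => e e_gt0.
  have small_e : \forall n \near \oo, disc_norm r0 (S n) <= e.
    exact: cvgr_le _ (S_vanishing r0_in) _ e_gt0.
  near=> n.
  have [|x_in x_root] := xP n; first by near: n.
  rewrite distrC; apply: (@le_trans _ _ (disc_norm r0 (S n))).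
    apply: perturbed_root_dist => //; first by rewrite /r0; lra.
    by rewrite ger0_norm; lra.
  by near: n.
- near=> n.
  have [|x_in x_root] := xP n; first by near: n.
  have x01 : 0 < x n < 1 by rewrite /r0 in x_in; lra.
  split=> //.
  have : root (map_poly (real_complex R) (alpha%:P - 'X + S n)) (x n)%:C.
    by rewrite fmorph_root.
  rewrite PE rootM root_prod_XsubC => /orP[|//]; apply: contraTT => _.
  apply: A_root; rewrite normr_real_complex ger0_norm; last by lra.
  by rewrite -[1](rmorph1 (real_complex R)) ltcR; lra.
- move=> r /andP[r_ge0 r_lt1]; pose r1 := Num.max r r0.
  have r1_in : 0 <= r1 < 1.
    by rewrite le_max r_ge0 gt_max r_lt1; case/andP: r0_in.
  have small1 : \forall n \near \oo, disc_norm r1 (S n) < 1.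
    exact: cvgr_lt _ (S_vanishing r1_in) _ ltr01.
  near=> n => w rest ws_perm; rewrite ltNge; apply/negP => wr.
  have : disc_norm r1 (S n) < 1 by near: n.
  apply/negP; rewrite -leNgt -lecR -disc_norm_complex.
  have [|x_in x_root] := xP n; first by near: n.
  have [r1_ge0 r1_lt1] := andP r1_in.
  apply: (@perturbed_root_simple _ _ alpha%:C (x n)%:C w _
           (A n * \prod_(z <- rest) ('X - z%:P))).
  + by rewrite ler0c.
  + by rewrite -[1](rmorph1 (real_complex R)) lecR ltW.
  + rewrite normr_real_complex lecR ger0_norm; last by rewrite /r0 in x_in; lra.
    by rewrite le_max; case/andP: x_in => _ ->; rewrite orbT.
  + by rewrite normr_normc lecR le_max wr.
  by rewrite -map_perturbed_linear PE (perm_big _ ws_perm) /= !big_cons; ring.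
Unshelve. all: by end_near. Qed.

End ZerosInDisc.

(** * The beta polynomial *)

Definition beta_coef (R : realType) (beta : R) (i : nat) : R :=
  1 - \sum_(k < i.+1) beta ^- k.+1.

Definition beta_poly (R : realType) (beta : R) (n : nat) : {poly R} :=
  'X^n + \poly_(i < n) beta_coef beta i.

Lemma char_poly_beta_mx (R : realType) (beta : R) n :
  char_poly (beta_mx beta n) = map_poly (real_complex R) (beta_poly beta n).
Proof.
pose u s : R[i] := (beta ^- s.+1)%:C - (s == 0 :> nat)%:R.
have -> : beta_mx beta n = \matrix_(s, t) (u s + (s == t.+1 :> nat)%:R).
  by apply/matrixP => s t; rewrite beta_mxE mxE.
rewrite char_poly_shift_rank1 rmorphD /= map_polyXn; congr (_ + _).
apply/polyP => i; rewrite coef_map !coef_poly /=; case: ltnP => // _.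
rewrite sumrB opprB rmorphB rmorph1 rmorph_sum; congr (_ - _).
by rewrite big_ord_recl big1 ?addr0.
Qed.

Section BetaPoly.
Variables (R : realType) (beta : R).
Hypothesis beta_gt1 : 1 < beta.
Let beta_gt0 : 0 < beta. Proof. exact: lt_trans ltr01 beta_gt1. Qed.
Let beta_neq0 : beta != 0. Proof. by rewrite gt_eqF. Qed.
Let b_gt0 : 0 < beta^-1. Proof. by rewrite invr_gt0. Qed.
Let b_lt1 : beta^-1 < 1. Proof. by rewrite invf_lt1. Qed.

Lemma beta_coefE i :
  (beta - 1) * beta_coef beta i = beta - 2 + beta^-1 ^+ i.+1.
Proof.
rewrite /beta_coef; elim: i => [|i IHi].
  by rewrite big_ord1 !expr1; field.
rewrite big_ord_recr /= opprD addrA mulrDr IHi -exprVn.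
by rewrite [_ ^+ i.+2]exprS; move: (_ ^+ i.+1) => x; field.
Qed.

Lemma size_beta_poly n : size (beta_poly beta n) = n.+1.
Proof. by rewrite size_polyDl size_polyXn // ltnS size_poly. Qed.

Lemma beta_polyS n : beta_poly beta n.+1 =
  beta_poly beta n + 'X^(n.+1) + (beta_coef beta n - 1)%:P * 'X^n.
Proof.
rewrite /beta_poly !poly_def big_ord_recr /= -mul_polyC.
by move: (beta_coef beta n) => a; rewrite polyCB polyC1; ring.
Qed.

(** The factors X - 1 and X - beta clear the denominators of the two geometric
    sums in the beta polynomial. *)
Definition inner_error n : {poly R} :=
  ('X - 1%:P) * ('X - beta%:P) * beta_poly beta n - ((beta - 1)%:P - 'X).

(** After reversal the progression of ratio 1 still has to be summed, which is
    what 1 - X does; the one of ratio 1/beta is already small. *)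
Definition outer_error n : {poly R} :=
  (beta - 1)%:P * (1 - 'X) * revp n (beta_poly beta n) - ((beta - 1)%:P - 'X).

(** The factor X^n makes the inner error small in the disc; its cofactor has
    degree 2 and coefficients bounded in n. *)
Lemma inner_errorE n : (beta - 1)%:P * inner_error n =
  ((beta - 1)%:P * 'X^2 + (beta^-1 ^+ n - 1 - (beta - 1) * beta)%:P * 'X
   + (beta - beta^-1 ^+ n)%:P) * 'X^n.
Proof.
rewrite /inner_error; elim: n => [|n IHn].
  rewrite /beta_poly poly_def big_ord0 !expr0.
  by rewrite !(polyCD, polyCN, polyCM, polyC1); ring.
have qE : (beta - 1)%:P * ('X^(n.+1) + (beta_coef beta n - 1)%:P * 'X^n) =
    ((beta - 1)%:P * 'X + (beta^-1 ^+ n.+1 - 1)%:P) * 'X^n.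
  have -> : beta^-1 ^+ n.+1 - 1 = (beta - 1) * (beta_coef beta n - 1).
    by rewrite mulrBr beta_coefE; ring.
  by rewrite polyCM polyCB polyC1 exprS; ring.
have bE : beta^-1 ^+ n = beta * beta^-1 ^+ n.+1 by rewrite exprS; field.
rewrite beta_polyS -addrA; set q := 'X^_ + _ in qE *.
set l := (_ - 'X) in IHn *; set p := beta_poly beta n in IHn *.
have -> : (beta - 1)%:P * (('X - 1%:P) * ('X - beta%:P) * (p + q) - l) =
    (beta - 1)%:P * (('X - 1%:P) * ('X - beta%:P) * p - l) +
    ('X - 1%:P) * ('X - beta%:P) * ((beta - 1)%:P * q) by ring.
rewrite IHn qE bE [X in _ = _ * X]exprS; move: (beta^-1 ^+ n.+1) => b.
by rewrite !(polyCD, polyCN, polyCM, polyC1); ring.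
Qed.

Lemma size_inner_error n : (size (inner_error n) <= n.+3)%N.
Proof.
rewrite (leq_trans (size_polyD _ _)) // size_polyN geq_max.
apply/andP; split.
  rewrite (leq_trans (size_polyMleq _ _)) // size_beta_poly addnS /=.
  by rewrite size_mul ?polyXsubC_eq0 // !size_XsubC.
rewrite (leq_trans (size_polyD _ _)) // size_polyN size_polyX geq_max.
by rewrite (leq_trans (size_polyC_leq1 _)).
Qed.

(** Only the coefficients of X^n, X^(n+1) and X^(n+2) are nonzero. They are
    bounded, and the factor beta^2 absorbs the powers
    beta^-(n+2-k) >= beta^-2. *)
Lemma inner_error_vanishing : vanishing inner_error.
Proof.
pose K := beta - 1 + (1 + (beta - 1) * beta) + beta.
apply: (@geometric_vanishing _ _ (K / (beta - 1) * beta ^+ 2) beta^-1).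
- by rewrite b_gt0.
- exact: size_inner_error.
move=> n k le_k.
have a_gt0 : 0 < beta - 1 by rewrite subr_gt0.
have bn_gt0 : 0 < beta^-1 ^+ n by rewrite exprn_gt0.
have bn_le1 : beta^-1 ^+ n <= 1 by rewrite exprn_ile1 // ltW.
have ab_gt0 : 0 < (beta - 1) * beta by rewrite mulr_gt0.
have K_gt0 : 0 < K by rewrite /K; lra.
have := congr1 (fun p : {poly R} => p`_k) (inner_errorE n).
rewrite coefCM coefMXn => SE.
have [lt_kn|le_nk] := ltnP k n.
  move: SE; rewrite lt_kn => /eqP; rewrite mulf_eq0 gt_eqF //= => /eqP ->.
  by rewrite normr0 !mulr_ge0 ?exprn_ge0 // ?invr_ge0 ltW.
have {SE} : `|(beta - 1) * (inner_error n)`_k| <= K.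
  rewrite SE ltnNge le_nk /= !coefD !coefCM coefX coefC coefXn.
  have : (k - n <= 2)%N by rewrite leq_subLR addn2.
  case: (k - n)%N => [|[|[|//]]] _ /=; rewrite ler_norml /K; lra.
rewrite normrM gtr0_norm // -ler_pdivlMl // mulrC => /le_trans; apply.
rewrite -mulrA ler_peMr //; first by rewrite divr_ge0 // ltW.
have : (n.+2 - k <= 2)%N by rewrite leq_subLR addn2.
case: (n.+2 - k)%N => [|[|[|//]]] _.
- by rewrite expr0 mulr1 exprn_ege1 // ltW.
- by rewrite expr1 expr2 mulfK // ltW.
- by rewrite exprVn mulfV // expf_neq0.
Qed.

(** The last summand corrects the leading coefficient of the beta polynomial,
    which is 1 and not the value predicted by the formula for the a_m. *)
Lemma coef_revp_beta_poly n k : (k <= n)%N ->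
  (beta - 1) * (revp n (beta_poly beta n))`_k =
  beta - 2 + beta^-1 ^+ (n.+1 - k) + (1 - beta^-1 ^+ n.+1) *+ (k == 0%N).
Proof.
move=> le_kn; rewrite coef_poly ltnS le_kn coefD coefXn coef_poly.
case: k le_kn => [|k] lt_kn.
  by rewrite subn0 eqxx ltnn addr0 mulr1 mulr1n subn0; ring.
have lt_n : (n - k.+1 < n)%N by rewrite ltn_subrL (leq_trans _ lt_kn).
by rewrite (ltn_eqF lt_n) lt_n add0r beta_coefE addr0 subSn.
Qed.

(** The constant parts alpha - 1 of consecutive coefficients cancel, except at
    the top degree n + 1 where a bounded coefficient is harmless. *)
Lemma outer_error_vanishing : vanishing outer_error.
Proof.
apply: (@geometric_vanishing _ _ ((beta + 1) * beta) beta^-1).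
- by rewrite b_gt0.
- move=> n; rewrite (leq_trans (size_polyD _ _)) // size_polyN geq_max.
  apply/andP; split; last first.
    rewrite (leq_trans (size_polyD _ _)) // size_polyN size_polyX geq_max.
    by rewrite (leq_trans (size_polyC_leq1 _)).
  rewrite -mulrA mul_polyC (leq_trans (size_scale_leq _ _)) //.
  rewrite (leq_trans (size_polyMleq _ _)) //.
  rewrite (leq_trans (leq_pred _)) // -[n.+3]/(2 + n.+1)%N leq_add ?size_poly //.
  by rewrite (leq_trans (size_polyD _ _)) // size_polyN size_polyX size_poly1.
move=> n k le_k.
have pow_in m : 0 < beta^-1 ^+ m <= 1.
  by rewrite exprn_gt0 // exprn_ile1 // ltW.
have M_ge0 : 0 <= (beta + 1) * beta.
  by apply: mulr_ge0; [apply: addr_ge0|]; rewrite ltW.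
rewrite /outer_error -mulrA mulrBl mul1r coefB coefCM !coefB coefXM coefC coefX.
case: k le_k => [|k] le_k /=.
  rewrite !subr0 coef_revp_beta_poly // subn0 mulr1n.
  rewrite (_ : _ - _ = 0) ?normr0; last by ring.
  by rewrite mulr_ge0 // exprn_ge0 // ltW.
rewrite sub0r opprK mulrBr eqSS.
have [le_nk|lt_kn] := leqP n k; last first.
  rewrite !coef_revp_beta_poly // 1?ltnW // addr0 !subSS.
  rewrite subSn 1?ltnW //.
  have -> : (beta + 1) * beta * beta^-1 ^+ (n - k).+1 =
      (beta + 1) * beta^-1 ^+ (n - k) by rewrite exprS; field.
  have /andP[B_gt0 _] := pow_in (n - k)%N.
  have /andP[bB_gt0 _] := pow_in (n - k).+1.
  have bB_le : beta^-1 ^+ (n - k).+1 <= beta^-1 ^+ (n - k).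
    by rewrite exprS ler_piMl ?ltW.
  have B_le : beta^-1 ^+ (n - k) <= (beta + 1) * beta^-1 ^+ (n - k).
    by rewrite ler_peMl ?ltW // ltrDr.
  case: k {le_k} lt_kn B_gt0 bB_gt0 bB_le B_le => [|k] _ B_gt0 bB_gt0 bB_le B_le.
    by rewrite /= subn0 mulr1n in B_gt0 bB_gt0 bB_le B_le *; rewrite ler_norml; lra.
  by rewrite /= mulr0n addr0 addr0 ler_norml; lra.
rewrite [(revp _ _)`_k.+1]nth_default ?(leq_trans (size_poly _ _)) // mulr0 sub0r.
have [lt_nk|le_kn] := ltnP n k.
  rewrite nth_default ?(leq_trans (size_poly _ _)) // mulr0 oppr0 add0r.
  by rewrite gtn_eqF ?(leq_ltn_trans _ lt_nk) // normr0 mulr_ge0 ?exprn_ge0 // ltW.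
rewrite coef_revp_beta_poly //.
have -> : n = k by apply/eqP; rewrite eqn_leq le_nk.
have -> : (k.+2 - k.+1 = 1)%N by rewrite subSS subSnn.
rewrite subSnn expr1 mulfK // ler_norml.
have [gt1 b_pos b_in] := And3 beta_gt1 b_gt0 b_lt1.
case: k {le_k le_nk le_kn} => [|k]; rewrite /= ?mulr1n ?mulr0n ?expr1.
  by lra.
by lra.
Qed.
End BetaPoly.

(** * Eigenvalues of the beta matrix and their inverses *)

Lemma map_revp (C D : nzRingType) (f : {rmorphism C -> D}) n (p : {poly C}) :
  map_poly f (revp n p) = revp n (map_poly f p).
Proof.
apply/polyP => i; rewrite coef_map coef_poly [RHS]coef_poly coef_map.
by case: ifP => _ //; exact: raddf0.
Qed.

(** The roots of the reversal of prod (X - z): a zero z lowers the degree of the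
    reversal instead of giving a root. *)
Definition nonzero_inverses (F : fieldType) (zs : seq F) : seq F :=
  [seq z^-1 | z <- zs & z != 0].

Lemma prod_1subZX (F : fieldType) (zs : seq F) :
  \prod_(z <- zs) (1 - z *: 'X) =
  (\prod_(z <- zs | z != 0) - z)%:P *
    \prod_(w <- nonzero_inverses zs) ('X - w%:P).
Proof.
rewrite big_map big_filter rmorph_prod -big_split /= [RHS]big_mkcond.
apply: eq_bigr => z _; case: eqVneq => [->|z_neq0] /=.
  by rewrite scale0r subr0.
rewrite mulrBr -polyCM mulNr mulfV // polyCN polyCN opprK mulNr mul_polyC.
by rewrite polyC1 addrC.
Qed.

Section BetaEigenvalues.
Variables (R : realType) (beta : R).
Hypothesis beta_gt1 : 1 < beta.
Let alpha := beta - 1.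
Let eig n := eigenvalues (beta_mx beta n).

Lemma beta_poly_eigenvalues n :
  map_poly (real_complex R) (beta_poly beta n) = \prod_(z <- eig n) ('X - z%:P).
Proof. by rewrite -char_poly_beta_mx char_poly_eigenvalues. Qed.

Lemma size_beta_eigenvalues n : size (eig n) = n.
Proof.
apply/eqP; rewrite -eqSS -(size_prod_XsubC (eig n) id) -beta_poly_eigenvalues.
by rewrite size_map_poly size_beta_poly.
Qed.

Let inner_factor (n : nat) : {poly R[i]} :=
  map_poly (real_complex R) (('X - 1%:P) * ('X - beta%:P)).

Lemma inner_factorization n :
  map_poly (real_complex R) (alpha%:P - 'X + inner_error beta n) =
  inner_factor n * \prod_(z <- eig n) ('X - z%:P).
Proof.
by rewrite addrC subrK rmorphM /= beta_poly_eigenvalues.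
Qed.

Lemma inner_factor_root n z : `|z| < 1 -> ~~ root (inner_factor n) z.
Proof.
rewrite /inner_factor rmorphM /= rootM !map_polyXsubC !root_XsubC.
apply: contraTN => /orP[] /eqP ->; rewrite normr_real_complex.
  by rewrite normr1 rmorph1 ltxx.
rewrite -[1](rmorph1 (real_complex R)) ltcR -leNgt gtr0_norm ?ltW //.
exact: lt_trans ltr01 beta_gt1.
Qed.

Let outer_factor n : {poly R[i]} :=
  map_poly (real_complex R) (alpha%:P * (1 - 'X)) *
  (\prod_(z <- eig n | z != 0) - z)%:P.

Lemma outer_factorization n :
  map_poly (real_complex R) (alpha%:P - 'X + outer_error beta n) =
  outer_factor n * \prod_(w <- nonzero_inverses (eig n)) ('X - w%:P).
Proof.
rewrite addrC subrK rmorphM /= map_revp beta_poly_eigenvalues.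
by rewrite -{1}(size_beta_eigenvalues n) revp_prod_XsubC prod_1subZX mulrA.
Qed.

Lemma outer_factor_root n z : `|z| < 1 -> ~~ root (outer_factor n) z.
Proof.
move=> z_lt1; rewrite /outer_factor rootM rmorphM /= map_polyC rmorphB rmorph1 /=.
rewrite map_polyX rootM !rootC fmorph_eq0 subr_eq0 gt_eqF //=.
rewrite negb_or rootE !hornerE subr_eq0; apply/andP; split.
  by apply: contraTneq z_lt1 => <-; rewrite normr1 ltxx.
by rewrite prodf_seq_neq0; apply/allP => w _; apply/implyP; rewrite oppr_eq0.
Qed.

End BetaEigenvalues.

(** * Distance to the unit circle *)

(** The point of the circle nearest to z is z / |z|, so that the distance is
    ||z| - 1|; take r >= 1 - eps and 1/r <= 1 + eps. *)
Lemma cdist_unit_circle_le (R : realType) (eps : R) : 0 < eps ->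
  exists2 r : R, 0 <= r < 1 & forall z : R[i],
    r < Normc.normc z -> (z != 0 -> r < Normc.normc z^-1) ->
    (cdist z unit_circle <= eps%:E)%E.
Proof.
move=> eps_gt0; have eps1_gt0 : 0 < 1 + eps by rewrite addr_gt0.
exists (Num.max (1 - eps) (1 + eps)^-1).
  have inv_gt0 : 0 < (1 + eps)^-1 by rewrite invr_gt0.
  by rewrite le_max (ltW inv_gt0) orbT gt_max invf_lt1 // ltrDl gtrBl eps_gt0.
move=> z; rewrite !gt_max => /andP[z1 z2].
have rho_gt0 : 0 < Normc.normc z by apply: lt_trans z2; rewrite invr_gt0.
have z_neq0 : z != 0.
  by apply: contraTneq rho_gt0 => ->; rewrite Normc.normc0 ltxx.
rewrite Normc.normcV z_neq0 => /(_ isT)/andP[_].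
rewrite ltf_pV2 ?posrE // => z3.
set rho := Normc.normc z in rho_gt0 z1 z3.
apply: (@le_trans _ _ (Normc.normc (z - z / rho%:C))%:E).
  apply: ereal_inf_lbound; exists (z / rho%:C) => //=.
  rewrite /unit_circle /= normrM normfV normr_real_complex (gtr0_norm rho_gt0).
  by rewrite normr_normc divff // eq_complex /= eqxx andbT gt_eqF.
rewrite lee_fin -lecR -normr_normc.
have -> : z - z / rho%:C = z * (1 - rho^-1)%:C.
  by rewrite rmorphB rmorph1 fmorphV mulrBr mulr1.
rewrite normrM normr_real_complex normr_normc -rmorphM lecR -/rho.
rewrite -{1}(gtr0_norm rho_gt0) -normrM mulrBr mulr1 divff ?gt_eqF //.
by rewrite ler_norml; lra.
Qed.

Lemma cclosed_unit_circle (R : realType) : cclosed (@unit_circle R).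
Proof.
apply: (@preimage_closed _ _ (fun z : R[i]^o => `|z|) [set 1]).
  by move=> z _; exact: norm_continuous.
apply: accessible_closed_set1; apply: hausdorff_accessible.
exact: norm_hausdorff.
Qed.

(** * Clustering of the eigenvalues *)

Lemma mem_nonzero_inverses (F : fieldType) (zs : seq F) z :
  z \in zs -> z != 0 -> z^-1 \in nonzero_inverses zs.
Proof. by move=> z_in z_neq0; rewrite map_f // mem_filter z_neq0. Qed.

Lemma perm_nonzero_inverses (F : fieldType) (zs : seq F) x z rest :
  perm_eq zs [:: x, z & rest] -> x != 0 -> z != 0 ->
  perm_eq (nonzero_inverses zs) [:: x^-1, z^-1 & nonzero_inverses rest].
Proof.
move=> zs_perm x_neq0 z_neq0.
have := perm_map GRing.inv (perm_filter (fun z => z != 0) zs_perm).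
by rewrite /= x_neq0 z_neq0.
Qed.

(** Here alpha >= 1, and neither the eigenvalues nor their inverses enter a disc
    of radius r < 1. *)
Lemma near_unit_circle_of_large_beta (R : realType) (beta eps : R) :
  2 <= beta -> 0 < eps -> \forall n \near \oo, forall z : R[i],
    z \in eigenvalues (beta_mx beta n) -> (cdist z unit_circle <= eps%:E)%E.
Proof.
move=> beta_ge2 eps_gt0; have [r r_in r_cdist] := cdist_unit_circle_le eps_gt0.
have beta_gt1 : 1 < beta by apply: lt_le_trans beta_ge2; rewrite ltrDr.
have alpha_ge1 : 1 <= beta - 1 by rewrite lerBrDr.
have inner := no_zeros_in_disc (inner_error_vanishing beta_gt1)
  (inner_factorization beta) alpha_ge1 r_in.
have outer := no_zeros_in_disc (outer_error_vanishing beta_gt1)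
  (outer_factorization beta) alpha_ge1 r_in.
near=> n => z z_in; apply: r_cdist => [|z_neq0].
  by move: z z_in; near: n.
have := mem_nonzero_inverses z_in z_neq0.
by move: (z^-1); near: n.
Unshelve. all: by end_near. Qed.

(** The two outliers are removed from the list of eigenvalues. Any further
    eigenvalue z stands in the list beside mu_n, and 1/z beside nu_n, so that
    both moduli |z| and |1/z| exceed r. *)
Lemma outliers_of_small_beta (R : realType) (beta : R) : 1 < beta -> beta < 2 ->
  exists (lam mu : nat -> R) (rest : nat -> seq R[i]),
  [/\ \forall n \near \oo,
        [/\ 0 < lam n, 0 < mu n
          & perm_eq (eigenvalues (beta_mx beta n))
                    [:: (lam n)%:C, (mu n)%:C & rest n]],
      lam @ \oo --> (beta - 1)^-1,
      mu @ \oo --> beta - 1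
    & forall eps : R, 0 < eps ->
        \forall n \near \oo,
          forall z : R[i], z \in rest n ->
            (cdist z unit_circle <= eps%:E)%E].
Proof.
move=> beta_gt1 beta_lt2.
have alpha_in : 0 < beta - 1 < 1.
  by rewrite subr_gt0 beta_gt1 ltrBlDr.
have [mu [mu_cvg mu_in mu_only]] := one_zero_in_disc
  (inner_error_vanishing beta_gt1) (inner_factor_root beta_gt1)
  (inner_factorization beta) alpha_in.
have [nu [nu_cvg nu_in nu_only]] := one_zero_in_disc
  (outer_error_vanishing beta_gt1) (outer_factor_root beta_gt1)
  (outer_factorization beta) alpha_in.
pose eig n := eigenvalues (beta_mx beta n).
pose rest n := rem (mu n)%:C (rem (nu n)^-1%:C (eig n)).
have eig_perm : \forall n \near \oo,
    [/\ 0 < mu n, 0 < nu n &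
        perm_eq (eig n) [:: (nu n)^-1%:C, (mu n)%:C & rest n]].
  near=> n.
  have [/andP[mu_gt0 mu_lt1] mu_eig] : 0 < mu n < 1 /\ (mu n)%:C \in eig n.
    by near: n.
  have [/andP[nu_gt0 nu_lt1] /mapP[z]] :
      0 < nu n < 1 /\ (nu n)%:C \in nonzero_inverses (eig n) by near: n.
  rewrite mem_filter => /andP[_ z_eig] nu_z.
  have {nu_z} zE : z = (nu n)^-1%:C by rewrite fmorphV /= nu_z invrK.
  rewrite zE in z_eig; split=> //.
  apply: perm_trans (perm_to_rem z_eig) _; rewrite perm_cons perm_to_rem //.
  move: mu_eig; rewrite (perm_mem (perm_to_rem z_eig)) inE => /orP[|//].
  (* The two outliers differ, as mu_n < 1 < 1 / nu_n. *)
  move=> /eqP/complexI mu_nu; move: mu_lt1; rewrite mu_nu invf_lt1 // => nu_gt1.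
  by have := lt_trans nu_lt1 nu_gt1; rewrite ltxx.
exists (fun n => (nu n)^-1), mu, rest; split => //.
- near=> n.
  have [mu_gt0 nu_gt0 ?] : [/\ 0 < mu n, 0 < nu n &
    perm_eq (eig n) [:: (nu n)^-1%:C, (mu n)%:C & rest n]] by near: n.
  by rewrite invr_gt0.
- by apply: cvgV => //; case/andP: alpha_in => /gt_eqF ->.
move=> eps eps_gt0; have [r r_in r_cdist] := cdist_unit_circle_le eps_gt0.
have mu_only_r := mu_only r r_in.
have nu_only_r := nu_only r r_in.
near=> n => z z_rest.
have [mu_gt0 nu_gt0 eig_n] : [/\ 0 < mu n, 0 < nu n &
  perm_eq (eig n) [:: (nu n)^-1%:C, (mu n)%:C & rest n]] by near: n.
have mu_only_n : forall w ws,
  perm_eq (eig n) [:: (mu n)%:C, w & ws] -> r < Normc.normc w by near: n.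
have nu_only_n : forall w ws,
    perm_eq (nonzero_inverses (eig n)) [:: (nu n)%:C, w & ws] ->
  r < Normc.normc w by near: n.
have {z_rest} eig_z : perm_eq (eig n)
    [:: (nu n)^-1%:C, (mu n)%:C, z & rem z (rest n)].
  by apply: perm_trans eig_n _; rewrite !perm_cons perm_to_rem.
apply: r_cdist => [|z_neq0].
  apply: (mu_only_n z ((nu n)^-1%:C :: rem z (rest n))).
  apply: perm_trans eig_z _.
  by rewrite (perm_catCA [:: (nu n)^-1%:C] [:: (mu n)%:C; z]).
have nu_neq0 : (nu n)^-1%:C != 0 :> R[i] by rewrite fmorph_eq0 invr_eq0 gt_eqF.
have : perm_eq (eig n) [:: (nu n)^-1%:C, z, (mu n)%:C & rem z (rest n)].
  apply: perm_trans eig_z _.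
  by rewrite perm_cons (perm_catCA [:: _] [:: _]).
move=> /perm_nonzero_inverses /(_ nu_neq0 z_neq0).
rewrite -fmorphV invrK; exact: nu_only_n.
Unshelve. all: by end_near. Qed.

Unset Implicit Arguments.

Theorem theorem4p1 (R : realType) (beta : R) (hbeta : 1 < beta) :
  [/\ strongly_clustered (beta_mx beta) unit_circle,
      2 <= beta ->
        forall eps : R, 0 < eps ->
        exists N : nat, forall n : nat, (N <= n)%N ->
        forall z : R[i], eigenvalue (beta_mx beta n) z ->
          ~ (eps%:E < cdist z unit_circle)%E
    & beta < 2 ->
        exists (lam mu : nat -> R) (rest : nat -> seq R[i]),
        [/\ \forall n \near \oo,
              [/\ 0 < lam n, 0 < mu n
                & perm_eq (eigenvalues (beta_mx beta n))
                          [:: (lam n)%:C, (mu n)%:C & rest n]],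
            lam @ \oo --> (beta - 1)^-1,
            mu @ \oo --> beta - 1
          & forall eps : R, 0 < eps ->
              \forall n \near \oo,
                forall z : R[i], z \in rest n ->
                  (cdist z unit_circle <= eps%:E)%E]].
Proof.
split; last exact: outliers_of_small_beta.
- split=> [|eps eps_gt0]; first exact: cclosed_unit_circle.
  have count0 (zs : seq R[i]) :
      (forall z, z \in zs -> (cdist z unit_circle <= eps%:E)%E) ->
      count (fun z => (eps%:E < cdist z unit_circle)%E) zs = 0%N.
    move=> zs_le; apply/eqP; rewrite -leqn0 leqNgt -has_count; apply/hasPn => z z_in.
    by rewrite -leNgt zs_le.
  have [beta_lt2|beta_ge2] := ltP beta 2.
    have [lam [mu [rest [eigE _ _ rest_le]]]] := outliers_of_small_beta hbeta beta_lt2.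
    have rest_le_eps := rest_le eps eps_gt0.
    exists 2%N; near=> n.
    have [_ _ /permP ->] : [/\ 0 < lam n, 0 < mu n
        & perm_eq (eigenvalues (beta_mx beta n))
                  [:: (lam n)%:C, (mu n)%:C & rest n]] by near: n.
    rewrite /= count0 ?addn0; first by do 2!case: (_ < _)%E.
    by near: n.
  have eig_le := near_unit_circle_of_large_beta beta_ge2 eps_gt0.
  exists 0%N; near=> n.
  by rewrite count0 //; near: n.
move=> beta_ge2 eps eps_gt0.
have [N _ eig_le] := near_unit_circle_of_large_beta beta_ge2 eps_gt0.
exists N => n le_Nn z; rewrite -mem_eigenvalues => z_eig.
by apply/negP; rewrite -leNgt; exact: eig_le z_eig.
Unshelve. all: by end_near. Qed.
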